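(* Let $f,g\in\mathbb{C}[x_1,\ldots,x_n]$ be two non-constant polynomials and $m\ge 0$ an integer. Let $b_1(s_1,s_2),\ldots,b_r(s_1,s_2)$ be nonzero generators of the Bernstein-Sato ideal $B_{f,g}\subset\mathbb{C}[s_1,s_2]$, and put $$\varepsilon=\min\{e_{b_i(s_1,s_2)}\mid i=1,\ldots,r\}-1,\qquad \gamma=\varepsilon-m.$$ Then: (1) if $\gamma\le 0$, then $I_m(s)=\mathrm{Sat}_{\mathbb{C}[s]}\bigl(I(s,-s-m)\bigr)$; (2) if $\gamma>0$, then, setting $J(s)=\mathrm{Sat}_{\mathbb{C}[s]}\bigl(I(s,-s-\varepsilon)\bigr)$ and writing $J(s-\gamma)$ for the left ideal obtained from $J(s)$ by replacing $s$ with $s-\gamma$, one has $I_m(s)=\pi\bigl(\mathrm{syz}_{D[s]}(f^{\gamma},J(s-\gamma))\bigr)$.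
   Context: $D=\mathbb{C}[x_1,\ldots,x_n]\langle\partial_1,\ldots,\partial_n\rangle$ is the $n$th Weyl algebra over $\mathbb{C}$ (with $\partial_i x_i=x_i\partial_i+1$), $D[s]=D\otimes_{\mathbb{C}}\mathbb{C}[s]$ and $D[s_1,s_2]=D\otimes_{\mathbb{C}}\mathbb{C}[s_1,s_2]$, where $s,s_1,s_2$ are commuting central variables. The free rank-one module $\mathbb{C}[x,s,\frac1{fg}]\left(\frac fg\right)^s$ is a left $D[s]$-module: polynomials in $x,s$ act by multiplication and $\partial_i\bullet u\left(\frac fg\right)^s=\left(\frac{\partial u}{\partial x_i}+s\,u\,\frac{\partial f/\partial x_i}{f}-s\,u\,\frac{\partial g/\partial x_i}{g}\right)\left(\frac fg\right)^s$ for $u\in\mathbb{C}[x,s,\frac1{fg}]$. Similarly the free rank-one module $\mathbb{C}[x,s_1,s_2,\frac1{fg}]f^{s_1}g^{s_2}$ is a left $D[s_1,s_2]$-module with $\partial_i\bullet u f^{s_1}g^{s_2}=\left(\frac{\partial u}{\partial x_i}+s_1u\frac{\partial f/\partial x_i}{f}+s_2u\frac{\partial g/\partial x_i}{g}\right)f^{s_1}g^{s_2}$. Here $f^{s_1+1}g^{s_2+1}$ means $fg\cdot f^{s_1}g^{s_2}$. $I_m(s)=\mathrm{Ann}_{D[s]}\frac1{g^m}\left(\frac fg\right)^s\subset D[s]$. $I(s_1,s_2)=\mathrm{Ann}_{D[s_1,s_2]}f^{s_1}g^{s_2}\subset D[s_1,s_2]$, and for an integer $k$, $I(s,-s-k)\subset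 D[s]$ is the left ideal obtained from $I(s_1,s_2)$ by the substitution $s_1=s$, $s_2=-s-k$. The Bernstein-Sato ideal $B_{f,g}\subset\mathbb{C}[s_1,s_2]$ (which is nonzero, by Sabbah) is the ideal of all $b(s_1,s_2)$ for which there is $P(s_1,s_2)\in D[s_1,s_2]$ with $b(s_1,s_2)f^{s_1}g^{s_2}=P(s_1,s_2)f^{s_1+1}g^{s_2+1}$. For nonzero $b(s_1,s_2)\in\mathbb{C}[s_1,s_2]$, let $L_{b(s_1,s_2)}=\{\ell\in\mathbb{Z}\mid s_1+s_2+\ell\text{ divides }b(s_1,s_2)\}$ (a finite set), and let $e_{b(s_1,s_2)}=1$ if $L_{b(s_1,s_2)}=\emptyset$ and $e_{b(s_1,s_2)}=\max L_{b(s_1,s_2)}$ otherwise. For a left ideal $I\subset D[s]$, $\mathrm{Sat}_{\mathbb{C}[s]}(I)=\{P(s)\in D[s]\mid \exists\, q(s)\in\mathbb{C}[s]\setminus\{0\},\ q(s)P(s)\in I\}$. For $P\in D[s]$ and a left ideal $I\subset D[s]$ generated by $Q_1,\ldots,Q_r$, $\mathrm{syz}_{D[s]}(P,I)$ denotes the left syzygy module $\{(A,R_1,\ldots,R_r)\in D[s]^{r+1}\mid AP+\sum_jR_jQ_j=0\}$, and $\pi:D[s]^{r+1}\to D[s]$ is the projection onto the first factor; thus $\pi(\mathrm{syz}_{D[s]}(P,I))=\{A\in D[s]\mid AP\in I\}$, independently of the chosen generators. *)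

(* Defs.v *)
From HB Require Import structures.
From mathcomp Require Import all_boot all_order all_algebra.
From mathcomp Require Import boolp classical_sets reals.
From mathcomp Require Import complex ring.
From mathcomp.multinomials Require Import ssrcomplements mpoly.

Set Implicit Arguments.
Unset Strict Implicit.
Unset Printing Implicit Defensive.

Import Order.TTheory GRing.Theory Num.Theory.
Local Open Scope ring_scope.
Local Open Scope classical_set_scope.

Local Notation "x %:F" := (@FracField.tofrac _ x).

(** * The Weyl algebra k[x_1, ..., x_n]<d_1, ..., d_n>

   An element is stored as its normal form [\sum_m a_m(x) d^m], encoded by the
   commutative polynomial [\sum_m a_m 'X^m] over [k[x]]. *)

Record weyl (n : nat) (k : comNzRingType) :=
  Weyl { symb : {mpoly {mpoly k[n]}[n]} }.

HB.instance Definition _ n k := [isNew for @symb n k].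
HB.instance Definition _ n k := [Choice of weyl n k by <:].

Section WeylAction.
Variables (n : nat) (k : comNzRingType) (S : comNzRingType).
Variables (iota : {mpoly k[n]} -> S) (nabla : 'I_n -> S -> S).

Definition iter_ops (m : 'X_{1..n}) (u : S) : S :=
  foldr (fun i => iter (m i) (nabla i)) u (enum 'I_n).

(* Action of a normal form when polynomials act by multiplication through
   [iota] and [d_i] acts by [nabla i]. *)
Definition symb_act (p : {mpoly {mpoly k[n]}[n]}) (u : S) : S :=
  \sum_(m <- msupp p) iota p@_m * iter_ops m u.

Definition wact (P : weyl n k) : S -> S := symb_act (symb P).

End WeylAction.

Section WeylRing.
Variables (n : nat) (k : comNzRingType).
Local Notation W := (weyl n k).
Local Notation A := {mpoly k[n]}.
Local Notation Sy := {mpoly A[n]}.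
Implicit Types (P Q : W).

(* Left multiplication by [d_i] on normal forms:
   [d_i a d^m = (d a / d x_i) d^m + a d^(m + e_i)]. *)
Definition dmul (i : 'I_n) (q : Sy) : Sy := map_mpoly (mderiv i) q + 'X_i * q.

Definition wzero : W := Weyl 0.
Definition wopp P : W := Weyl (- symb P).
Definition wadd P Q : W := Weyl (symb P + symb Q).
Definition wone : W := Weyl 1.
Definition wmul P Q : W := Weyl (wact (@mpolyC n A) dmul P (symb Q)).

Definition wpoly (a : A) : W := Weyl a%:MP.
Definition wder (i : 'I_n) : W := Weyl 'X_i.

Fact waddA : associative wadd.
Proof. by move=> P Q T; congr Weyl; rewrite /= addrA. Qed.
Fact waddC : commutative wadd.
Proof. by move=> P Q; congr Weyl; rewrite addrC. Qed.
Fact wadd0 : left_id wzero wadd.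
Proof. by move=> P; apply: val_inj; rewrite /= add0r. Qed.
Fact waddN : left_inverse wzero wopp wadd.
Proof. by move=> P; apply: val_inj; rewrite /= addNr. Qed.

HB.instance Definition _ := GRing.isZmodule.Build W waddA waddC wadd0 waddN.

Fact map_mpoly_mono (f : {additive A -> A}) a m :
  map_mpoly f (a%:MP * 'X_[m]) = (f a)%:MP * 'X_[m] :> Sy.
Proof.
apply/mpolyP => m'; rewrite mcoeff_map_mpoly /= !mcoeffCM !mcoeffX.
by case: eqP; rewrite ?mulr1 // !mulr0 raddf0.
Qed.

Fact dmul_is_additive i : zmod_morphism (dmul i).
Proof. by move=> p q; rewrite /dmul raddfB mulrBr opprD addrACA. Qed.
HB.instance Definition _ i :=
  GRing.isZmodMorphism.Build Sy Sy (dmul i) (dmul_is_additive i).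

Section Action.
Variables (S : comNzRingType) (iota : {rmorphism A -> S}).
Variable nabla : 'I_n -> {additive S -> S}.
Local Notation sact := (symb_act iota (fun i => nabla i)).
Local Notation itn := (iter_ops (fun i => nabla i)).

Lemma symb_actE b p u : (msize p <= b)%N ->
  sact p u = \sum_(m : 'X_{1..n < b}) iota p@_m * itn m u.
Proof.
move=> le_pb; set I : subFinType _ := 'X_{1..n < b}.
rewrite /symb_act (big_mksub I) ?msupp_uniq //=; first last.
  by move=> x /msize_mdeg_lt /leq_trans; apply.
rewrite big_rmcond //= => j /memN_msupp_eq0 ->.
by rewrite rmorph0 mul0r.
Qed.

Lemma symb_actD p q u : sact (p + q) u = sact p u + sact q u.
Proof.
pose b := maxn (msize (p + q)) (maxn (msize p) (msize q)).
rewrite !(@symb_actE b) ?leq_max ?leqnn ?orbT // -big_split.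
by apply: eq_bigr => m _; rewrite mcoeffD rmorphD mulrDl.
Qed.

Lemma symb_act0 u : sact 0 u = 0.
Proof. by rewrite /symb_act msupp0 big_nil. Qed.

Lemma symb_act_sum (I : Type) (r : seq I) (F : I -> Sy) u :
  sact (\sum_(j <- r) F j) u = \sum_(j <- r) sact (F j) u.
Proof.
by elim/big_ind2: _ => [|p x q y <- <-|//]; rewrite ?symb_act0 ?symb_actD.
Qed.

Lemma symb_actZ a p u : sact (a%:MP * p) u = iota a * sact p u.
Proof.
pose b := maxn (msize (a%:MP * p)) (msize p).
rewrite !(@symb_actE b) ?leq_max ?leqnn ?orbT // mulr_sumr.
by apply: eq_bigr => m _; rewrite mcoeffCM rmorphM mulrA.
Qed.

Lemma symb_actX m u : sact 'X_[m] u = itn m u.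
Proof. by rewrite /symb_act msuppX big_seq1 mcoeffX eqxx rmorph1 mul1r. Qed.

Lemma iter_opsD m u v : itn m (u + v) = itn m u + itn m v.
Proof.
rewrite /iter_ops; elim: (enum _) => //= i s ->.
by elim: (m i) => //= j ->; rewrite raddfD.
Qed.

Lemma symb_actDr p u v : sact p (u + v) = sact p u + sact p v.
Proof.
by rewrite -big_split; apply: eq_bigr => m _; rewrite /= iter_opsD mulrDr.
Qed.

Hypothesis nabla_comm : forall i j u, nabla i (nabla j u) = nabla j (nabla i u).

Lemma iter_opsU i m u : itn (U_(i) + m)%MM u = nabla i (itn m u).
Proof.
have cI (s : seq 'I_n) v : i \notin s ->
    foldr (fun j => iter ((U_(i) + m)%MM j) (nabla j)) v s =
    foldr (fun j => iter (m j) (nabla j)) v s.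
  elim: s => //= j s IH; rewrite inE negb_or => /andP[ij /IH ->].
  by rewrite mnmDE mnm1E (negbTE ij).
have cN j l v : iter l (nabla j) (nabla i v) = nabla i (iter l (nabla j) v).
  by elim: l => //= l ->; rewrite nabla_comm.
rewrite /iter_ops; have := mem_enum 'I_n i; have := enum_uniq 'I_n.
elim: (enum _) => //= j s IH /andP[js us].
rewrite inE mnmDE mnm1E; have [eij _|ij /= si] := eqVneq i j.
  by rewrite -eij in js *; rewrite add1n /= cI.
by rewrite add0n IH.
Qed.

Hypothesis nabla_leibniz :
  forall i a u, nabla i (iota a * u) = iota a^`M(i) * u + iota a * nabla i u.

Lemma symb_act_dmul i q u : sact (dmul i q) u = nabla i (sact q u).
Proof.
elim/mpolyind: q => [|a m q _ _ IH]; first by rewrite raddf0 symb_act0 raddf0.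
rewrite [dmul i _]raddfD /= !symb_actD raddfD -IH -mul_mpolyC; congr (_ + _); last by rewrite -symb_actD.
rewrite /dmul map_mpoly_mono mulrCA -mpolyXD /=.
by rewrite !symb_actZ !symb_actX iter_opsU nabla_leibniz.
Qed.

Lemma wactM P Q u :
  wact iota (fun i => nabla i) (wmul P Q) u =
  wact iota (fun i => nabla i) P (wact iota (fun i => nabla i) Q u).
Proof.
rewrite /wact /= [X in sact X _]/symb_act symb_act_sum; apply: eq_bigr => m _.
rewrite symb_actZ; congr (_ * _).
rewrite /iter_ops; elim: (enum _) => //= i s <-.
by elim: (m i) => //= j <-; rewrite symb_act_dmul.
Qed.

End Action.

Fact dmul_comm i j q : dmul i (dmul j q) = dmul j (dmul i q).
Proof.
pose D l (p : Sy) : Sy := map_mpoly (mderiv l) p.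
have DX l l' p : D l ('X_l' * p) = 'X_l' * D l p.
  rewrite /D (mpolyE p) mulr_sumr !raddf_sum mulr_sumr; apply: eq_bigr => m _ /=.
  by rewrite -mul_mpolyC mulrCA -mpolyXD !map_mpoly_mono mulrCA -mpolyXD.
have cE l p m : (D l p)@_m = (p@_m)^`M(l) by exact: mcoeff_map_mpoly.
have DC p : D i (D j p) = D j (D i p).
  have cE2 l l' m := etrans (cE l _ m) (congr1 (mderiv l) (cE l' p m)).
  apply/mpolyP => m.
  exact: etrans (cE2 _ _ _) (etrans (mderiv_comm _ _ _) (esym (cE2 _ _ _))).
have DD l p r : D l (p + r) = D l p + D l r by exact: raddfD.
change (D i (D j q + 'X_j * q) + 'X_i * (D j q + 'X_j * q) =
        D j (D i q + 'X_i * q) + 'X_j * (D i q + 'X_i * q)).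
rewrite !(DD i) !(DD j) (DX i) (DX j) DC.
move: (D j (D i q)) (D i q) (D j q) ('X_i : Sy) ('X_j : Sy) => a b c x y.
by rewrite !mulrDr addrACA (mulrCA x).
Qed.

Fact dmul_leibniz i (a : A) (q : Sy) :
  dmul i (a%:MP * q) = (a^`M(i))%:MP * q + a%:MP * dmul i q.
Proof.
rewrite /dmul mulrDr addrA mulrCA; congr (_ + _).
apply/mpolyP => m; rewrite mcoeffD !mcoeff_map_mpoly /= !mcoeffCM mderivM.
by rewrite mcoeff_map_mpoly.
Qed.

Fact wmulA : associative wmul.
Proof.
move=> P Q T; apply: val_inj => /=; apply/esym.
exact: (@wactM _ (@mpolyC n A) dmul dmul_comm dmul_leibniz).
Qed.

Fact wmul1 : left_id wone wmul.
Proof.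
move=> P; apply: val_inj => /=; rewrite /wact /= -mpolyX0.
rewrite (@symb_actX _ (@mpolyC n A) dmul) /iter_ops.
by elim: (enum _) => //= i s ->; rewrite mnm0E.
Qed.

Fact wmulr1 : right_id wone wmul.
Proof.
have dX i m : map_mpoly (mderiv i) 'X_[m] = 0 :> Sy.
  by rewrite -['X_[m]]mul1r -mpolyC1 map_mpoly_mono /= mderivC mpolyC0 mul0r.
move=> P; apply: val_inj => /=; rewrite /wact /symb_act.
rewrite [RHS]mpolyE; apply: eq_bigr => m _; rewrite -mul_mpolyC; congr (_ * _).
rewrite [m in RHS]multinomUE_id /iter_ops /index_enum -enumT.
elim: (enum _) => [|i s /= ->]; first by rewrite big_nil mpolyX0.
rewrite big_cons; set m' := (\sum_(j <- s) _)%MM.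
elim: (m i) => [|l /= ->]; first by rewrite mulm0n add0m.
rewrite mulmS -addmA /dmul.
by rewrite -!mpolyXD dX add0r.
Qed.

Fact wmulDl : left_distributive wmul wadd.
Proof.
by move=> P Q T; apply: val_inj; apply: (@symb_actD _ (@mpolyC n A) dmul).
Qed.

Fact wmulDr : right_distributive wmul wadd.
Proof.
by move=> P Q T; apply: val_inj; apply: (@symb_actDr _ (@mpolyC n A) dmul).
Qed.

Fact wone_neq0 : wone != wzero.
Proof. by rewrite -val_eqE /= oner_eq0. Qed.

HB.instance Definition _ :=
  GRing.Zmodule_isNzRing.Build W wmulA wmul1 wmulr1 wmulDl wmulDr wone_neq0.

End WeylRing.

Lemma wder_poly (n : nat) (k : comNzRingType) (i : 'I_n) (a : {mpoly k[n]}) :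
  wder k i * wpoly a = wpoly a * wder k i + wpoly a^`M(i).
Proof.
apply: val_inj => /=.
have hX := @symb_actX n k _ (@mpolyC n _) (@dmul n k).
rewrite /wact /= hX -[X in symb_act _ _ X]mulr1.
rewrite (@symb_actZ n k _ (@mpolyC n _) (@dmul n k)) -mpolyX0 hX.
have it0 q : iter_ops (@dmul n k) 0%MM q = q.
  by rewrite /iter_ops; elim: (enum _) => //= j s ->; rewrite mnm0E.
have it1 q : iter_ops (@dmul n k) U_(i)%MM q = dmul i q.
  rewrite -[U_(i)%MM]addm0 -[in RHS](it0 q).
  exact: (@iter_opsU n _ (@dmul n k) (@dmul_comm n k)).
by rewrite it1 it0 /dmul map_mpolyC addrC mulrC.
Qed.

Lemma frac_reprE (R : idomainType) (u : {fraction R}) :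
  u = (\n_(repr u))%:F / (\d_(repr u))%:F.
Proof.
have nz : (\d_(repr u))%:F != 0 by rewrite tofrac_eq0 denom_ratioP.
apply: (canRL (mulfK nz)); rewrite -{1}[u]reprK; move: (repr u) nz => x _.
unlock FracField.tofrac; rewrite -[LHS]FracField.pi_mul.
apply/eqmodP; rewrite /= FracField.equivfE /FracField.mulf.
by rewrite !numden_Ratio ?oner_eq0 ?mulf_neq0 ?denom_ratioP ?oner_eq0 // !mulr1 mulrC.
Qed.

Lemma frac_eq (R : idomainType) (a b c d : R) : b != 0 -> d != 0 ->
  (a%:F / b%:F == c%:F / d%:F) = (a * d == c * b).
Proof.
by move=> b0 d0; rewrite eqr_div ?tofrac_eq0 // -!tofracM tofrac_eq.
Qed.

(** * Modules generated by complex powers *)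

Section TwistedAction.
Variables (n : nat) (k : idomainType).
Local Notation R := {mpoly k[n]}.
Local Notation K := {fraction R}.

(* The derivation [d / d x_i] of the fraction field; the quotient rule does not
   depend on the representative, see [fderivE]. *)
Definition fderiv (i : 'I_n) (u : K) : K :=
  let a := \n_(repr u) in let b := \d_(repr u) in
  (a^`M(i) * b - a * b^`M(i))%:F / (b ^+ 2)%:F.

Variables (f g : R) (al be : k).

(* [d_i] acting on the coefficient [u] of [u f^al g^be]. *)
Definition tnabla (i : 'I_n) (u : K) : K :=
  fderiv i u + (al%:MP * f^`M(i))%:F / f%:F * u
             + (be%:MP * g^`M(i))%:F / g%:F * u.

(* Action of [k[x]<d>] on [u f^al g^be].  We let [u] range over the whole
   fraction field of [k[x]]; [k[x, 1/(f g)] f^al g^be] is a submodule by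
   [pow_act_loc], and annihilators of its elements are the same in both. *)
Definition pow_act (P : weyl n k) (u : K) : K :=
  wact (@FracField.tofrac R) tnabla P u.

Definition loc (h : R) : set K := [set u | exists a j, u = a%:F / h%:F ^+ j].

Lemma fderivE i a b : b != 0 ->
  fderiv i (a%:F / b%:F) = (a^`M(i) * b - a * b^`M(i))%:F / (b ^+ 2)%:F.
Proof.
move=> b0; rewrite /fderiv; set u := a%:F / b%:F.
have /eqP := frac_reprE u; move: (denom_ratioP (repr u)).
move: (\n_ (repr u)) (\d_ (repr u)) => c d d0.
rewrite frac_eq // => /eqP e; apply/eqP; rewrite frac_eq ?expf_neq0 //; apply/eqP.
have := congr1 (mderiv i) e; rewrite !mderivM.
move: (a^`M(i)) (b^`M(i)) (c^`M(i)) (d^`M(i)) e => a' b' c' d' e e'.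
have -> : (c' * d - c * d') * b ^+ 2 = b * d * (c' * b) - c * b * (d' * b) by ring.
have -> : c' * b = a' * d + a * d' - c * b' by rewrite e' addrK.
have -> : b * d * (a' * d + a * d' - c * b') - c * b * (d' * b) =
          (a' * b) * d ^+ 2 + a * d * d' * b - c * b * (d * b') - c * b * (d' * b).
  by ring.
by rewrite -e; ring.
Qed.

Fact frac_ind (Pr : K -> Prop) :
  (forall a b, b != 0 -> Pr (a%:F / b%:F)) -> forall u, Pr u.
Proof. by move=> H u; rewrite (frac_reprE u); apply/H/denom_ratioP. Qed.

Lemma fderivF i a : fderiv i a%:F = (a^`M(i))%:F.
Proof.
rewrite -[X in fderiv i X]divr1 -tofrac1 fderivE ?oner_eq0 // -mpolyC1 mderivC.
by rewrite mpolyC1 mulr0 subr0 mulr1 expr1n tofrac1 divr1.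
Qed.

Lemma fderivB i u v : fderiv i (u - v) = fderiv i u - fderiv i v.
Proof.
have eq1 (F : fieldType) (a b c d : F) : b != 0 -> d != 0 ->
    a / b - c / d = (a * d - c * b) / (b * d).
  by move=> b0 d0; field; rewrite b0 d0.
have eq2 (F : fieldType) (a b c d a' b' c' d' : F) : b != 0 -> d != 0 ->
    (((a' * d + a * d') - (c' * b + c * b')) * (b * d)
      - (a * d - c * b) * (b' * d + b * d')) / (b * d) ^+ 2
    = (a' * b - a * b') / b ^+ 2 - (c' * d - c * d') / d ^+ 2.
  by move=> b0 d0; field; rewrite b0 d0.
elim/frac_ind: u => a b b0; elim/frac_ind: v => c d d0.
have bF : b%:F != 0 by rewrite tofrac_eq0.
have dF : d%:F != 0 by rewrite tofrac_eq0.
rewrite (eq1 _ a%:F b%:F c%:F d%:F bF dF).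
rewrite -!tofracM -tofracB !fderivE ?mulf_neq0 // mderivB !mderivM.
rewrite !(tofracB, tofracD, tofracM, tofracXn).
exact: (eq2 _ _ _ _ _ _ _ _ _ bF dF).
Qed.

Lemma fderivM i u v : fderiv i (u * v) = fderiv i u * v + u * fderiv i v.
Proof.
have eq1 (F : fieldType) (a b c d a' b' c' d' : F) : b != 0 -> d != 0 ->
    ((a' * c + a * c') * (b * d) - a * c * (b' * d + b * d')) / (b * d) ^+ 2
    = (a' * b - a * b') / b ^+ 2 * (c / d)
      + a / b * ((c' * d - c * d') / d ^+ 2).
  by move=> b0 d0; field; rewrite b0 d0.
elim/frac_ind: u => a b b0; elim/frac_ind: v => c d d0.
have bF : b%:F != 0 by rewrite tofrac_eq0.
have dF : d%:F != 0 by rewrite tofrac_eq0.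
rewrite mulf_div -!tofracM !fderivE ?mulf_neq0 // !mderivM.
rewrite !(tofracB, tofracD, tofracM, tofracXn).
exact: (eq1 _ _ _ _ _ _ _ _ _ bF dF).
Qed.

Lemma fderivC i j u : fderiv i (fderiv j u) = fderiv j (fderiv i u).
Proof.
elim/frac_ind: u => a b b0.
rewrite !fderivE ?expf_neq0 // expr2 !(mderivB, mderivM) (mderiv_comm j i a).
rewrite (mderiv_comm j i b); congr (_%:F / _).
move: (a^`M(i)) (b^`M(i)) (a^`M(j)) (b^`M(j)) (a^`M(i)^`M(j)) (b^`M(i)^`M(j)).
by move=> ai bi aj bj aij bij; ring.
Qed.

Fact tnabla_is_additive i : zmod_morphism (tnabla i).
Proof.
have eq1 (F : fieldType) (p q x y u v : F) :
    p - q + x * (u - v) + y * (u - v) = p + x * u + y * u - (q + x * v + y * v).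
  by ring.
by move=> u v; rewrite /tnabla fderivB; exact: eq1.
Qed.
HB.instance Definition _ i :=
  GRing.isZmodMorphism.Build K K (tnabla i) (tnabla_is_additive i).

Lemma tnabla_leibniz i a u :
  tnabla i (a%:F * u) = (a^`M(i))%:F * u + a%:F * tnabla i u.
Proof.
by rewrite /tnabla fderivM fderivF 2!(mulrCA _ a%:F u) !mulrDr !addrA.
Qed.

Fact dlogC h (c : k) i j :
  fderiv i ((c%:MP * h^`M(j))%:F / h%:F) = fderiv j ((c%:MP * h^`M(i))%:F / h%:F).
Proof.
have [->|h0] := eqVneq h 0.
  by rewrite !mderiv0 !mulr0 tofrac0 mul0r -tofrac0 !fderivF !mderiv0.
rewrite !fderivE // !mderiv_mulC (mderiv_comm j i).
by congr (_%:F / _); ring.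
Qed.

Lemma tnabla_comm i j u : tnabla i (tnabla j u) = tnabla j (tnabla i u).
Proof.
have fD l v w : fderiv l (v + w) = fderiv l v + fderiv l w.
  by rewrite -{1}[w]opprK fderivB -[- w]sub0r fderivB -(subrr 0) fderivB !subrr sub0r opprK.
have eq1 (F : fieldType) (d di dj p q fi fj gi gj w : F) :
    d + (p * w + fj * di) + (q * w + gj * di) + fi * (dj + fj * w + gj * w)
      + gi * (dj + fj * w + gj * w)
    = d + (p * w + fi * dj) + (q * w + gi * dj) + fj * (di + fi * w + gi * w)
      + gj * (di + fi * w + gi * w) by ring.
have := dlogC g be i j; have := dlogC f al i j; rewrite /tnabla.
move: (_ / f%:F) (_ / f%:F) (_ / g%:F) (_ / g%:F) => fi fj gi gj ef eg.
rewrite !(fD i) !(fD j) (fderivM i fj) (fderivM i gj) (fderivM j fi).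
rewrite (fderivM j gi) ef eg fderivC.
exact: eq1.
Qed.

Lemma pow_actM P Q u : pow_act (P * Q) u = pow_act P (pow_act Q u).
Proof.
exact: (@wactM n k K (@FracField.tofrac R) tnabla tnabla_comm tnabla_leibniz).
Qed.

Lemma pow_actD P Q u : pow_act (P + Q) u = pow_act P u + pow_act Q u.
Proof. exact: (@symb_actD n k K (@FracField.tofrac R) tnabla). Qed.

Lemma pow_act_poly a u : pow_act (wpoly a) u = a%:F * u.
Proof.
rewrite /pow_act /wact /= -[X in symb_act _ _ X]mulr1 -mpolyX0.
rewrite (@symb_actZ n k K (@FracField.tofrac R) tnabla).
rewrite (@symb_actX n k K (@FracField.tofrac R) tnabla) /iter_ops.
by congr (_ * _); elim: (enum _) => //= i s ->; rewrite mnm0E.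
Qed.

Lemma pow_act_der i u : pow_act (wder k i) u = tnabla i u.
Proof.
rewrite /pow_act /wact (@symb_actX n k K (@FracField.tofrac R) tnabla).
rewrite -[U_(i)%MM]addm0 (@iter_opsU n K tnabla tnabla_comm) /iter_ops.
by congr tnabla; elim: (enum _) => //= j s ->; rewrite mnm0E.
Qed.

Lemma pow_act_loc P u : f != 0 -> g != 0 -> loc (f * g) u ->
  loc (f * g) (pow_act P u).
Proof.
move=> f0 g0; set h := f * g; have h0 : h != 0 by rewrite mulf_neq0.
have fF : f%:F != 0 by rewrite tofrac_eq0.
have gF : g%:F != 0 by rewrite tofrac_eq0.
have hF : h%:F != 0 by rewrite tofrac_eq0.
have eqc (a b c : R) : b != 0 -> c != 0 -> a%:F / b%:F = (a * c)%:F / (b * c)%:F.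
  move=> b0 c0; apply/eqP; rewrite frac_eq ?mulf_neq0 //.
  by rewrite (mulrC b) mulrA.
have locD v w : loc h v -> loc h w -> loc h (v + w).
  move=> [a [l ->]] [b [m ->]]; exists (a * h ^+ m + b * h ^+ l), (l + m)%N.
  rewrite addf_div ?expf_neq0 // -!tofracXn exprD.
  by rewrite !(tofracD, tofracM, tofracXn).
have locM v w : loc h v -> loc h w -> loc h (v * w).
  move=> [a [l ->]] [b [m ->]]; exists (a * b), (l + m)%N.
  by rewrite mulf_div exprD tofracM.
have locF a : loc h a%:F by exists a, 0%N; rewrite expr0 divr1.
have locT i v : loc h v -> loc h (tnabla i v).
  move=> lv; apply: (locD); first apply: (locD).
  - case: lv => [a [l ->]]; rewrite -tofracXn fderivE ?expf_neq0 //.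
    exists (a^`M(i) * h ^+ l - a * (h ^+ l)^`M(i)), (l * 2)%N.
    by rewrite -exprM tofracXn.
  - apply: (locM) => //; exists (al%:MP * f^`M(i) * g), 1%N.
    by rewrite expr1; apply: eqc.
  - apply: (locM) => //; exists (be%:MP * g^`M(i) * f), 1%N.
    by rewrite expr1 /h (mulrC f); apply: eqc.
move=> lu; rewrite /pow_act /wact /symb_act.
elim/big_ind: _ => [|//|m _]; first by rewrite -tofrac0.
apply: (locM) => //; rewrite /iter_ops; elim: (enum _) => //= i s IH.
by elim: (m i) => //= l; apply: (locT).
Qed.

End TwistedAction.


(** * Ideals of D[s] and D[s_1, s_2] *)

(* Coefficientwise change of the ring of constants. *)
Definition wmap (n : nat) (k k' : comNzRingType) (phi : k -> k')
  (P : weyl n k) : weyl n k' := Weyl (map_mpoly (map_mpoly phi) (symb P)).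

Section LeftIdeals.
Variable A : nzRingType.

Definition left_ideal_of (r : nat) (Q : 'I_r -> A) : set A :=
  [set P | exists B : 'I_r -> A, P = \sum_(j < r) B j * Q j].

Definition syz (r : nat) (P : A) (Q : 'I_r -> A) : set (A * ('I_r -> A)) :=
  [set AB | AB.1 * P + \sum_(j < r) AB.2 j * Q j = 0].

(* [colon P I] is the projection on the first factor of [syz P Q] for every
   family [Q] of generators of [I], see [syz_colon]. *)
Definition colon (P : A) (I : set A) : set A := [set B | I (B * P)].

Lemma syz_colon (r : nat) (P : A) (Q : 'I_r -> A) :
  fst @` syz P Q = colon P (left_ideal_of Q).
Proof.
apply/seteqP; split=> [_ [[B T] /= e <-]|B [T e]].
  exists (fun j => - T j); move/eqP: e; rewrite addr_eq0 => /eqP ->.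
  by rewrite -sumrN; apply: eq_bigr => j _; rewrite mulNr.
exists (B, fun j => - T j) => //; rewrite /syz /= e -big_split big1 // => j _.
by rewrite /= mulNr subrr.
Qed.

End LeftIdeals.

Section BernsteinSato.
Variables (C : fieldType) (n : nat).

Local Notation Cs := {poly C}.
Local Notation Css := {mpoly C[2]}.

(* [D (x) C[s]] and [D (x) C[s_1, s_2]] are the Weyl algebras with constants
   [C[s]] and [C[s_1, s_2]]; in particular the [s]'s are central. *)
Definition Ds := weyl n Cs.
Definition Dss := weyl n Css.

Definition s1 : Css := 'X_ord0.
Definition s2 : Css := 'X_ord_max.

Definition to_s (f : {mpoly C[n]}) : {mpoly Cs[n]} := map_mpoly polyC f.
Definition to_ss (f : {mpoly C[n]}) : {mpoly Css[n]} := map_mpoly (@mpolyC 2 C) f.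

Variables f g : {mpoly C[n]}.

(* Action of [D[s]] on [u (f/g)^s], and of [D[s_1, s_2]] on [u f^s1 g^s2]. *)
Definition act_s : Ds -> {fraction {mpoly Cs[n]}} -> {fraction {mpoly Cs[n]}} :=
  pow_act (to_s f) (to_s g) 'X (- 'X).
Definition act_ss :
    Dss -> {fraction {mpoly Css[n]}} -> {fraction {mpoly Css[n]}} :=
  pow_act (to_ss f) (to_ss g) s1 s2.

Definition ann_s (m : nat) : set Ds :=
  [set P | act_s P (1 / (to_s g)%:F ^+ m) = 0].

Definition ann_ss : set Dss := [set P | act_ss P 1 = 0].

(* The substitution [s_1 = s, s_2 = - s - l]. *)
Definition specialize (l : int) : Css -> Cs :=
  mmap polyC (fun i : 'I_2 => if i == ord0 then 'X else - 'X - l%:~R).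

(* [I(s, -s-l)].  Substitution is a surjective ring morphism
   [D[s_1, s_2] -> D[s]], so the image is already a left ideal. *)
Definition ann_spec (l : int) : set Ds := wmap (specialize l) @` ann_ss.

Definition sat (I : set Ds) : set Ds :=
  [set P | exists q : Cs, q != 0 /\ I (wpoly q%:MP * P)].

(* [J(s) |-> J(s - c)]. *)
Definition shift (c : int) (J : set Ds) : set Ds :=
  wmap (fun p : Cs => p \Po ('X - c%:~R)) @` J.

Definition BS_ideal : set Css :=
  [set b | exists P : Dss, (b%:MP)%:F = act_ss P (to_ss f * to_ss g)%:F].

Definition generates (r : nat) (b : 'I_r -> Css) (I : set Css) : Prop :=
  I = [set c | exists a : 'I_r -> Css, c = \sum_(i < r) a i * b i].

Definition Lset (b : Css) : set int :=
  [set l | exists q : Css, b = q * (s1 + s2 + l%:~R)].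

(* In characteristic 0 the set [Lset b] is finite when [b != 0], so its maximum
   exists as soon as it is nonempty and the default value 0 is not reached. *)
Definition e_of (b : Css) : int :=
  if `[< Lset b = set0 >] then 1
  else xget 0 [set l | Lset b l /\ forall l', Lset b l' -> l' <= l].

Definition epsilon (r : nat) (b : 'I_r.+1 -> Css) : int :=
  \big[Num.min/e_of (b ord0)]_(i < r.+1) e_of (b i) - 1.

End BernsteinSato.

(* Main.v *)
Require Import Defs.
From HB Require Import structures.
From mathcomp Require Import all_boot all_order all_algebra.
From mathcomp Require Import boolp classical_sets reals.
From mathcomp Require Import complex ring.
From mathcomp.multinomials Require Import mpoly.

Set Implicit Arguments.
Unset Strict Implicit.
Unset Printing Implicit Defensive.

Import Order.TTheory GRing.Theory Num.Theory.
Local Open Scope ring_scope.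
Local Open Scope classical_set_scope.

(** Let [P] annihilate [g^-l (f/g)^s].  Read in [D[s_1]], it sends [f^s1 g^s2] to
   some [a (f g)^-N f^s1 g^s2] where [a] vanishes on [s_1 + s_2 + l = 0].
   Iterating a functional equation of [b] in the Bernstein-Sato ideal gives [Q]
   with [Q f^s1 g^s2 = B (f g)^-N f^s1 g^s2], [B] being the product of the
   [b(s_1 - j, s_2 - j)] for [1 <= j <= N].  Hence [B P - a Q] annihilates
   [f^s1 g^s2] and specializes to [B(s, -s-l) P].  The scalar [B(s, -s-l)] is
   nonzero as soon as no [l + 2 j] is in the set [L_b], which holds for
   [l >= e_b - 1].  So the annihilator of [g^-l (f/g)^s] is the saturation of
   [I(s, -s-l)] for all [l >= epsilon]; for smaller exponents one multiplies by
   [f^gamma] and shifts [s], since [f^gamma f^(s-gamma) g^(-(s-gamma)-epsilon)]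
   is [g^-m (f/g)^s]. *)

Local Notation "x %:F" := (@FracField.tofrac _ x).

(** * Change of constants *)

Lemma wpolyM n (k : comNzRingType) (a : {mpoly k[n]}) (P : weyl n k) :
  wpoly a * P = Weyl (a%:MP * symb P).
Proof.
apply: val_inj => /=; rewrite /wact /= -[X in symb_act _ _ X]mulr1 -mpolyX0.
rewrite (@symb_actZ n k _ (@mpolyC n _) (@dmul n k)).
rewrite (@symb_actX n k _ (@mpolyC n _) (@dmul n k)) /iter_ops.
by congr (_ * _); elim: (enum _) => //= i s ->; rewrite mnm0E.
Qed.

(** Normal forms are sums of terms a(x) d^m, so compatibility with an action is checked on
    polynomials and on monomials in the derivations. *)
Lemma weyl_ind n (k : comNzRingType) (Pr : weyl n k -> Prop) :
  Pr 0 -> (forall a m P, Pr P -> Pr (wpoly a * Weyl 'X_[m] + P)) ->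
  forall P, Pr P.
Proof.
move=> P0 PD [p]; elim/mpolyind: p => [//|a m p _ _ IH].
by rewrite -mul_mpolyC; have := PD a m _ IH; rewrite wpolyM.
Qed.

Section ChangeOfConstants.
Variables (n : nat) (k k' : comNzRingType) (phi : {rmorphism k -> k'}).

Lemma map_mpoly_deriv i (a : {mpoly k[n]}) :
  map_mpoly phi a^`M(i) = (map_mpoly phi a)^`M(i).
Proof.
apply/mpolyP => m.
by rewrite mcoeff_map_mpoly !mcoeff_deriv mcoeff_map_mpoly /= rmorphMn.
Qed.

Lemma wmap_poly (a : {mpoly k[n]}) (P : weyl n k) :
  wmap phi (wpoly a * P) = wpoly (map_mpoly phi a) * wmap phi P.
Proof.
rewrite !wpolyM /wmap /=; congr Weyl; apply/mpolyP => m.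
by rewrite mcoeff_map_mpoly /= !mcoeffCM mcoeff_map_mpoly /= rmorphM.
Qed.

Lemma wmapD (P Q : weyl n k) : wmap phi (P + Q) = wmap phi P + wmap phi Q.
Proof. by congr Weyl; rewrite /= raddfD. Qed.

Lemma wmap0 : wmap phi (0 : weyl n k) = 0.
Proof. by apply: val_inj; rewrite /= raddf0. Qed.

Lemma wmapX m : wmap phi (Weyl 'X_[m] : weyl n k) = Weyl 'X_[m].
Proof. by congr Weyl; rewrite /= [LHS]mmapX mmap1_id. Qed.

Lemma wpoly0 : wpoly (0 : {mpoly k[n]}) = 0.
Proof. by apply: val_inj; rewrite /= mpolyC0. Qed.

End ChangeOfConstants.

Lemma symb_wmap n (k k' : comNzRingType) (phi : {rmorphism k -> k'})
    (P : weyl n k) m :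
  (symb (wmap phi P))@_m = map_mpoly phi (symb P)@_m.
Proof. exact: mcoeff_map_mpoly. Qed.

Lemma map_map_mpoly n (k1 k2 k3 : comNzRingType) (phi : {rmorphism k1 -> k2})
    (psi : {rmorphism k2 -> k3}) (chi : {rmorphism k1 -> k3}) (a : {mpoly k1[n]}) :
  (forall x, psi (phi x) = chi x) ->
  map_mpoly psi (map_mpoly phi a) = map_mpoly chi a.
Proof. by move=> e; apply/mpolyP => m; rewrite !mcoeff_map_mpoly; apply: e. Qed.

Lemma wmap_comp n (k1 k2 k3 : comNzRingType) (phi : {rmorphism k1 -> k2})
    (psi : {rmorphism k2 -> k3}) (chi : {rmorphism k1 -> k3}) (P : weyl n k1) :
  (forall x, psi (phi x) = chi x) -> wmap psi (wmap phi P) = wmap chi P.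
Proof.
move=> e; apply: val_inj; apply/mpolyP => m; rewrite [LHS]symb_wmap.
rewrite [in LHS]symb_wmap [RHS]symb_wmap; exact: map_map_mpoly.
Qed.

Lemma wmap_id n (k : comNzRingType) (phi : {rmorphism k -> k}) (P : weyl n k) :
  phi =1 id -> wmap phi P = P.
Proof.
move=> e; apply: val_inj; apply/mpolyP => m; rewrite [LHS]symb_wmap.
by apply/mpolyP => m'; rewrite mcoeff_map_mpoly [LHS]e.
Qed.

Lemma pow_act_polyM n (k : idomainType) (f g a : {mpoly k[n]}) al be P u :
  pow_act f g al be (wpoly a * P) u = a%:F * pow_act f g al be P u.
Proof. by rewrite [LHS]pow_actM [LHS]pow_act_poly. Qed.

Lemma pow_act_mon n (k : idomainType) (f g : {mpoly k[n]}) al be m u :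
  pow_act f g al be (Weyl 'X_[m]) u = iter_ops (tnabla f g al be) m u.
Proof. exact: (@symb_actX n k _ (@FracField.tofrac _) (tnabla f g al be)). Qed.

(** * Specialization of constants in the twisted action *)

Section Specialization.
Variables (n : nat) (k k' : idomainType) (phi : {rmorphism k -> k'}).
Local Notation R := {mpoly k[n]}.
Local Notation R' := {mpoly k'[n]}.
Local Notation ph := (map_mpoly phi : R -> R').

(* [u] lies in the localization of [k[x]] at the kernel of [phi], and [u'] is
   its image. *)
Definition specializes (u : {fraction R}) (u' : {fraction R'}) : Prop :=
  exists a c, [/\ ph c != 0, u = a%:F / c%:F & u' = (ph a)%:F / (ph c)%:F].

Lemma map_mpoly_neq0 (c : R) : ph c != 0 -> c != 0.
Proof. by apply: contra_neq => ->; rewrite raddf0. Qed.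

Lemma specializes_tofrac a : specializes a%:F (ph a)%:F.
Proof.
by exists a, 1; rewrite rmorph1 oner_eq0 !tofrac1 !divr1.
Qed.

Lemma specializes1 : specializes 1 1.
Proof. by have := specializes_tofrac 1; rewrite !rmorph1. Qed.

Lemma specializesD u u' v v' :
  specializes u u' -> specializes v v' -> specializes (u + v) (u' + v').
Proof.
move=> [a [b [b0 -> ->]]] [c [d [d0 -> ->]]].
exists (a * d + c * b), (b * d); split.
- by rewrite rmorphM mulf_neq0.
- by rewrite addf_div ?tofrac_eq0 ?map_mpoly_neq0 // tofracD !tofracM.
- by rewrite addf_div ?tofrac_eq0 // rmorphD /= !rmorphM /= tofracD !tofracM.
Qed.

Lemma specializesM u u' v v' :
  specializes u u' -> specializes v v' -> specializes (u * v) (u' * v').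
Proof.
move=> [a [b [b0 -> ->]]] [c [d [d0 -> ->]]].
exists (a * c), (b * d); split; first by rewrite rmorphM mulf_neq0.
  by rewrite mulf_div !tofracM.
by rewrite mulf_div !rmorphM.
Qed.

(** Cross-multiplying gives an identity of polynomials that [ph] preserves, and the denominators
    stay nonzero: the specialized value does not depend on the fraction chosen. *)
Lemma specializes_fun u u' u'' : specializes u u' -> specializes u u'' -> u' = u''.
Proof.
move=> [a [b [b0 -> ->]]] [c [d [d0 + ->]]] => /eqP.
rewrite frac_eq ?map_mpoly_neq0 // => /eqP/(congr1 ph) e; apply/eqP.
by rewrite frac_eq // -!rmorphM /= e.
Qed.

Lemma specializes_eq0 u u' : specializes u u' -> u = 0 -> u' = 0.
Proof.
move=> + u0; rewrite u0 => /specializes_fun; apply.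
by have := specializes_tofrac 0; rewrite !raddf0.
Qed.

Lemma specializes_fderiv i u u' :
  specializes u u' -> specializes (fderiv i u) (fderiv i u').
Proof.
move=> [a [b [b0 -> ->]]]; rewrite !fderivE ?map_mpoly_neq0 //.
exists (a^`M(i) * b - a * b^`M(i)), (b ^+ 2); split=> //.
  by rewrite rmorphXn expf_neq0.
have -> : ph (a^`M(i) * b - a * b^`M(i)) =
          (ph a)^`M(i) * ph b - ph a * (ph b)^`M(i).
  by rewrite rmorphB !rmorphM /= !map_mpoly_deriv.
by rewrite [ph (b ^+ 2)]rmorphXn.
Qed.

Variables (f g : R) (al be : k).
Hypotheses (f_neq0 : ph f != 0) (g_neq0 : ph g != 0).

(** Specialization commutes with the derivations and with the logarithmic derivatives of f and g,
    whose denominators survive [ph]; hence with each [tnabla], and with the action by induction on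
    normal forms. *)
Lemma specializes_pow_act P u u' : specializes u u' ->
  specializes (pow_act f g al be P u)
              (pow_act (ph f) (ph g) (phi al) (phi be) (wmap phi P) u').
Proof.
move=> uu'.
elim/weyl_ind: P => [|a m P IH].
  have := specializes_tofrac 0.
  by rewrite wmap0 !raddf0 /pow_act /wact /symb_act /= !msupp0 !big_nil.
rewrite wmapD wmap_poly wmapX !pow_actD; apply: specializesD => //.
rewrite ![pow_act _ _ _ _ (_ * _) _]pow_act_polyM; apply: specializesM.
  exact: specializes_tofrac.
rewrite !pow_act_mon.
have st i v v' : specializes v v' ->
    specializes (tnabla f g al be i v)
                (tnabla (ph f) (ph g) (phi al) (phi be) i v').
  move=> vv'.
  have dlog h c : ph h != 0 ->
      specializes ((c%:MP * h^`M(i))%:F / h%:F * v)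
                  (((phi c)%:MP * (ph h)^`M(i))%:F / (ph h)%:F * v').
    move=> h0; apply: specializesM => //; exists (c%:MP * h^`M(i)), h.
    have <- : ph (c%:MP * h^`M(i)) = (phi c)%:MP * (ph h)^`M(i).
      by rewrite rmorphM /= map_mpoly_deriv map_mpolyC.
    by [].
  apply: specializesD; last exact: dlog.
  by apply: specializesD; [apply: specializes_fderiv|apply: dlog].
rewrite /iter_ops; elim: (enum _) => //= i s.
by elim: (m i) => //= j IHj /IHj /st.
Qed.

End Specialization.

(** * Logarithmic derivatives and change of exponents *)

Section Gauge.
Variables (n : nat) (k : idomainType) (f g : {mpoly k[n]}).
Local Notation K := {fraction {mpoly k[n]}}.

(* [w] behaves like [f^c g^d]. *)
Definition dlog (w : K) (c d : k) : Prop := forall i,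
  fderiv i w = ((c%:MP * f^`M(i))%:F / f%:F + (d%:MP * g^`M(i))%:F / g%:F) * w.

(** Formally w f^al g^be = f^(al+c) g^(be+d): moving w to the left across [tnabla] adds (c, d) to
    the exponents. *)
Lemma pow_act_gauge al be w c d P u : dlog w c d ->
  pow_act f g al be P (w * u) = w * pow_act f g (al + c) (be + d) P u.
Proof.
move=> dw; rewrite /pow_act /wact /symb_act mulr_sumr; apply: eq_bigr => m _.
rewrite mulrCA; congr (_ * _); rewrite /iter_ops; elim: (enum _) => //= i s ->.
elim: (m i) => //= j ->; move: (iter _ _ _) => v.
rewrite /tnabla fderivM dw !mpolyCD !mulrDl !tofracD.
move: (_ %:F) (_ %:F) (_ %:F) (_ %:F) => a1 a2 a3 a4.
by ring.
Qed.

Lemma dlogM w w' c c' d d' : dlog w c d -> dlog w' c' d' ->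
  dlog (w * w') (c + c') (d + d').
Proof.
move=> dw dw' i; rewrite fderivM dw dw' !mpolyCD !mulrDl !tofracD.
move: (_ %:F) (_ %:F) (_ %:F) (_ %:F) => a1 a2 a3 a4.
by ring.
Qed.

Lemma dlog_const c : dlog (c%:MP)%:F 0 0.
Proof.
by move=> i; rewrite !mpolyC0 !mul0r addr0 mul0r fderivF mderivC tofrac0.
Qed.

Lemma dlog1 : dlog 1 0 0.
Proof. by rewrite -tofrac1 -mpolyC1; apply: dlog_const. Qed.

(** Differentiate w w^-1 = 1. *)
Lemma dlogV w c d : w != 0 -> dlog w c d -> dlog w^-1 (- c) (- d).
Proof.
move=> w0 dw i; apply: (mulfI w0).
have := dlog1 i; rewrite -{1}(mulfV w0) fderivM dw !mpolyC0 !mul0r addr0 mul0r.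
move=> /eqP; rewrite addrC addr_eq0 => /eqP ->.
have eq1 (F : fieldType) (x y z : F) :
    - ((x + y) * z * z^-1) = z * ((- x - y) * z^-1) by ring.
rewrite !mpolyCN !mulNr !tofracN !mulNr; exact: eq1.
Qed.

Lemma dlogXn w c d j : dlog w c d -> dlog (w ^+ j) (c *+ j) (d *+ j).
Proof.
move=> dw; elim: j => [|j IH]; first by rewrite !mulr0n; apply: dlog1.
by rewrite exprS !mulrS; apply: dlogM.
Qed.

Lemma dlog_l : f != 0 -> dlog f%:F 1 0.
Proof.
move=> f0 i; rewrite fderivF mpolyC1 mul1r mpolyC0 !mul0r addr0.
by rewrite divfK ?tofrac_eq0.
Qed.

Lemma dlog_r : g != 0 -> dlog g%:F 0 1.
Proof.
move=> g0 i; rewrite fderivF mpolyC1 mul1r mpolyC0 !mul0r add0r.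
by rewrite divfK ?tofrac_eq0.
Qed.

End Gauge.

(** * Functional equations *)

Section FunctionalEquation.
Variables (n : nat) (k : idomainType) (tau : {rmorphism k -> k}).
Variables (f g : {mpoly k[n]}) (al be : k).
Hypotheses (f_neq0 : f != 0) (g_neq0 : g != 0).
Hypotheses (tau_f : map_mpoly tau f = f) (tau_g : map_mpoly tau g = g).
Hypotheses (tau_al : tau al = al - 1) (tau_be : tau be = be - 1).
Local Notation h := (f * g).
Local Notation act := (pow_act f g al be).

Let h_neq0 : h != 0. Proof. exact: mulf_neq0. Qed.
Let hF_neq0 : h%:F != 0. Proof. by rewrite tofrac_eq0 h_neq0. Qed.

(** The factor c/h behaves like f^-1 g^-1, so it lowers both exponents by 1, which is exactly what
    [tau] does to them. The first hypothesis says that u is fixed by [tau]. *)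
Lemma act_tau (c : k) P u v :
  specializes tau u u -> specializes tau (act P u) v ->
  act (wmap tau P) ((c%:MP)%:F / h%:F * u) = (c%:MP)%:F / h%:F * v.
Proof.
have dh : dlog f g h%:F (1 + 0) (0 + 1).
  rewrite tofracM; exact: dlogM (dlog_l _ f_neq0) (dlog_r _ g_neq0).
have dw : dlog f g ((c%:MP)%:F / h%:F) (0 - (1 + 0)) (0 - (0 + 1)).
  exact: dlogM (dlog_const _ _ c) (dlogV hF_neq0 dh).
rewrite (pow_act_gauge _ _ _ _ dw) => uu su; congr (_ * _).
rewrite addr0 !add0r -tau_al -tau_be.
have := specializes_pow_act (phi := tau) al be (f := f) (g := g).
rewrite tau_f tau_g => /(_ f_neq0 g_neq0 P _ _ uu).
by move=> /specializes_fun; apply.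
Qed.

(* The numerator is the product of [tau b, ..., tau^N b]. *)
Lemma functional_equation_iter (b : k) P N : act P h%:F = (b%:MP)%:F ->
  exists Q, act Q 1 = ((iter N (fun c => tau (b * c)) 1)%:MP)%:F / h%:F ^+ N.
Proof.
move=> bP; have tF (a : {mpoly k[n]}) := specializes_tofrac tau a.
have th : map_mpoly tau h = h by rewrite rmorphM /= tau_f tau_g.
elim: N => [|N [Q eQ]].
  exists (wpoly 1); rewrite pow_act_poly /= mpolyC1.
  by rewrite expr0 divr1 mulr1.
(* [wmap tau P] turns 1 into tau(b)/h; by [act_tau], [wmap tau Q] then passes this factor and
   contributes tau(c)/h^N. *)
set c := iter N _ _ in eQ; exists (wmap tau Q * wmap tau P).
have eP : act (wmap tau P) 1 = ((tau b)%:MP)%:F / h%:F.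
  have := @act_tau 1 P h%:F ((tau b)%:MP)%:F.
  rewrite mpolyC1 tofrac1 mul1r mulVf // => ->.
  - by rewrite mulrC.
  - by have := tF h; rewrite th.
  - by rewrite bP; have := tF b%:MP; rewrite map_mpolyC.
have sQ : specializes tau (act Q 1) (((tau c)%:MP)%:F / h%:F ^+ N).
  have thN : map_mpoly tau (h ^+ N) = h ^+ N by rewrite rmorphXn /= th.
  rewrite eQ -tofracXn; exists c%:MP, (h ^+ N); split=> //.
  - by rewrite thN expf_neq0.
  - by rewrite thN map_mpolyC.
move: (act_tau (tau b) (specializes1 n tau) sQ) eP.
set x := _ / h%:F; move: (wmap tau P) (wmap tau Q) => P' Q'.
rewrite [x * 1]mulr1 pow_actM => e ->; rewrite e.
by rewrite /x mulf_div -tofracM -mpolyCM -exprS -rmorphM.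
Qed.

End FunctionalEquation.

(** * Lifting annihilators along a specialization *)

Section Lifting.
Variables (n : nat) (k k' : idomainType) (phi : {rmorphism k -> k'}).
Variables (f g : {mpoly k[n]}) (al be : k).
Variables (f' g' : {mpoly k'[n]}) (al' be' : k').
Local Notation ph := (map_mpoly phi).
Hypotheses (f_eq : ph f = f') (g_eq : ph g = g').
Hypotheses (al_eq : phi al = al') (be_eq : phi be = be').
Hypotheses (f_neq0 : f' != 0) (g_neq0 : g' != 0).
Local Notation h := (f * g).

(* [P f^al g^be = a h^-N] with [a] in the kernel of the specialization, so
   [B P - a Q] annihilates [f^al g^be] and specializes to [B P]. *)
Lemma lift_annihilator (B : nat -> k) (P : weyl n k) (P' : weyl n k') :
  wmap phi P = P' ->
  (forall N, exists Q, pow_act f g al be Q 1 = ((B N)%:MP)%:F / h%:F ^+ N) ->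
  pow_act f' g' al' be' P' 1 = 0 ->
  exists N T, pow_act f g al be T 1 = 0 /\
    wmap phi T = wpoly (phi (B N))%:MP * P'.
Proof.
move: f_neq0 g_neq0; rewrite -f_eq -g_eq -al_eq -be_eq => f0 g0 <- BQ P0.
have h0 : h != 0 := mulf_neq0 (map_mpoly_neq0 f0) (map_mpoly_neq0 g0).
have [a [N aE]] : loc h (pow_act f g al be P 1).
  apply: pow_act_loc; [exact: map_mpoly_neq0 f0|exact: map_mpoly_neq0 g0|].
  by exists 1, 0%N; rewrite expr0 tofrac1 divr1.
(* The value of P on 1, multiplied by h^N, is a. It specializes to 0, as P' annihilates 1, and also
   to [ph a]. *)
have a0 : ph a = 0.
  have := specializes_pow_act al be f0 g0 P (specializes1 n phi).
  rewrite P0 => /(specializesM (specializes_tofrac phi (h ^+ N))).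
  rewrite aE tofracXn mulrCA mulfV ?expf_neq0 ?tofrac_eq0 // mulr1 mulr0.
  move=> /(specializes_fun (specializes_tofrac phi a)).
  by move=> /eqP; rewrite tofrac_eq0 => /eqP.
have [Q QE] := BQ N.
exists N, (wpoly (B N)%:MP * P + wpoly (- a) * Q); split.
  rewrite pow_actD [X in X + _]pow_act_polyM [X in _ + X]pow_act_polyM aE QE.
  by rewrite tofracN mulNr mulrCA subrr.
have aN : ph (- a) = 0 by rewrite rmorphN /= a0 oppr0.
rewrite [LHS]wmapD [X in X + _]wmap_poly [X in _ + X]wmap_poly aN wpoly0.
by rewrite mul0r addr0 map_mpolyC.
Qed.

End Lifting.

(** * Annihilators and multiplication by a power of f *)

Section ShiftColon.
Variables (n : nat) (k : idomainType) (phi psi : {rmorphism k -> k}).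
Variables (f g : {mpoly k[n]}) (al be : k) (c : nat).
Hypotheses (f_neq0 : f != 0) (g_neq0 : g != 0).
Hypotheses (phi_f : map_mpoly phi f = f) (phi_g : map_mpoly phi g = g).
Hypotheses (psi_f : map_mpoly psi f = f) (psi_g : map_mpoly psi g = g).
Hypothesis phiK : cancel phi psi.

(** Since f^c f^(al-c) = f^al, A annihilates f^al g^be exactly when A f^c annihilates f^(al-c) g^be;
    T is A f^c transported by [phi]. *)
Lemma annihilator_shift A : pow_act f g al be A 1 = 0 <->
  exists T, pow_act f g (phi (al - c%:R)) (phi be) T 1 = 0 /\
    wmap psi T = A * wpoly (f ^+ c).
Proof.
have key : pow_act f g (al - c%:R) be (A * wpoly (f ^+ c)) 1 =
    f%:F ^+ c * pow_act f g al be A 1.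
  have df := dlogXn c (dlog_l g f_neq0).
  rewrite [LHS]pow_actM pow_act_poly tofracXn (pow_act_gauge _ _ _ _ df).
  by rewrite mul0rn addr0 subrK.
have fF : f%:F ^+ c != 0 by rewrite expf_neq0 // tofrac_eq0.
split=> [A0|[T [T0 TA]]].
  exists (wmap phi (A * wpoly (f ^+ c))); split; last first.
    by rewrite (@wmap_comp _ _ _ _ phi psi idfun) ?wmap_id.
  have := specializes_pow_act (phi := phi) (al - c%:R) be (f := f) (g := g).
  rewrite phi_f phi_g => /(_ f_neq0 g_neq0 (A * wpoly (f ^+ c)) _ _ (specializes1 n phi)).
  by move=> /specializes_eq0; apply; rewrite key A0 mulr0.
have := specializes_pow_act (phi := psi) (phi (al - c%:R)) (phi be) (f := f) (g := g).
rewrite psi_f psi_g => /(_ f_neq0 g_neq0 T _ _ (specializes1 n psi)).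
move=> /specializes_eq0/(_ T0)/eqP; rewrite TA !phiK key mulf_eq0.
by rewrite (negbTE fF) => /eqP.
Qed.

End ShiftColon.

(** * Substitutions in C[s_1, s_2] *)

Lemma mpoly_rmorph_ext (n : nat) (k S : comNzRingType)
    (F G : {rmorphism {mpoly k[n]} -> S}) :
  (forall c, F c%:MP = G c%:MP) -> (forall i, F 'X_i = G 'X_i) -> F =1 G.
Proof.
move=> eC eX p; rewrite [p]mpolyE !rmorph_sum /=; apply: eq_bigr => m _.
rewrite -mul_mpolyC !rmorphM /= eC; congr (_ * _).
rewrite mpolyXE_id !rmorph_prod /=; apply: eq_bigr => i _.
by rewrite !rmorphXn /= eX.
Qed.

Lemma poly_rmorph_ext (k S : nzRingType) (F G : {rmorphism {poly k} -> S}) :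
  (forall c, F c%:P = G c%:P) -> F 'X = G 'X -> F =1 G.
Proof.
move=> eC eX; elim/poly_ind => [|p c IH]; first by rewrite !raddf0.
by rewrite !rmorphD !rmorphM /= IH eX eC.
Qed.

Section Substitutions.
Variable C : fieldType.
Local Notation Cs := {poly C}.
Local Notation Css := {mpoly C[2]}.
Local Notation s1 := (s1 C).
Local Notation s2 := (s2 C).

HB.instance Definition _ l := GRing.RMorphism.copy (@specialize C l)
  (mmap polyC (fun i : 'I_2 => if i == ord0 then 'X else - 'X - l%:~R)).

Definition tau : Css -> Css := mmap (@mpolyC 2 C) (fun i => 'X_i - 1).
HB.instance Definition _ := GRing.RMorphism.copy tau
  (mmap (@mpolyC 2 C) (fun i => 'X_i - 1)).

(** Reads s as s_1; a common section of all the maps [specialize l]. *)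
Definition lift_s : {rmorphism Cs -> Css} := horner_eval s1 \o map_poly (@mpolyC 2 C).

(* [s1 |-> s, s2 |-> - s - l] with [l] a new variable. *)
Definition antidiag : {rmorphism Css -> {poly Cs}} :=
  mmap (@polyC Cs \o @polyC C)
       (fun i : 'I_2 => if i == ord0 then 'X%:P else - 'X%:P - 'X).

(** The inverse substitution: s becomes s_1 and the new variable becomes -s_1 - s_2. *)
Definition antidiag_inv : {rmorphism {poly Cs} -> Css} :=
  horner_eval (- s1 - s2) \o map_poly lift_s.

Lemma ord2E (i : 'I_2) : i = ord0 \/ i = ord_max.
Proof.
by case: i => [[|[|//]] Hi]; [left|right]; apply: val_inj.
Qed.

Lemma specializeC l (c : C) : specialize l c%:MP = c%:P.
Proof. exact: mmapC. Qed.

Lemma specialize_s1 l : specialize l s1 = 'X.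
Proof. by rewrite /specialize /s1 mmapX mmap1U. Qed.

Lemma specialize_s2 l : specialize l s2 = - 'X - l%:~R.
Proof. by rewrite /specialize /s2 mmapX mmap1U. Qed.

Lemma tauC (c : C) : tau c%:MP = c%:MP.
Proof. exact: mmapC. Qed.

Lemma tauX i : tau 'X_i = 'X_i - 1.
Proof. by rewrite /tau mmapX mmap1U. Qed.

Lemma lift_sC (c : C) : lift_s c%:P = c%:MP.
Proof. by rewrite /lift_s /= map_polyC /= /horner_eval hornerC. Qed.

Lemma lift_sX : lift_s 'X = s1.
Proof. by rewrite /lift_s /= map_polyX /horner_eval hornerX. Qed.

Lemma specialize_lift_s l c : specialize l (lift_s c) = c.
Proof.
apply: (@poly_rmorph_ext _ _ (specialize l \o lift_s) idfun) => [a|].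
  by rewrite -[LHS]/(specialize l (lift_s _)) lift_sC specializeC.
by rewrite -[LHS]/(specialize l (lift_s _)) lift_sX specialize_s1.
Qed.

(** The shift by 2 comes from -s - l - 1 = -(s - 1) - (l + 2). *)
Lemma specialize_tau l c : specialize l (tau c) = specialize (l + 2) c \Po ('X - 1).
Proof.
apply: (@mpoly_rmorph_ext _ _ _ (specialize l \o tau)
  (comp_poly ('X - 1) \o specialize (l + 2))) => [a|i] /=.
  by rewrite tauC !specializeC comp_polyC.
rewrite tauX rmorphB rmorph1 /=.
have [->|->] := ord2E i; first by rewrite !specialize_s1 comp_polyX.
rewrite specialize_s2 [specialize (l + 2) _]specialize_s2.
rewrite rmorphB rmorphN /= comp_polyX -[_%:~R \Po _]/(comp_poly _ _) rmorph_int.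
by rewrite intrD; ring.
Qed.

Lemma antidiag_specialize l b : specialize l b = (antidiag b).[l%:~R].
Proof.
apply: (@mpoly_rmorph_ext _ _ _ (specialize l)
  (horner_eval l%:~R \o antidiag)) => [a|i] /=; rewrite /horner_eval.
  by rewrite specializeC [antidiag _]mmapC /= hornerC.
have [->|->] := ord2E i; rewrite /antidiag mmapX mmap1U /=.
  by rewrite specialize_s1 hornerC.
by rewrite specialize_s2 !hornerE.
Qed.

Lemma antidiag_invC p : antidiag_inv p%:P = lift_s p.
Proof. by rewrite [LHS]/= map_polyC /horner_eval hornerC. Qed.

Lemma antidiag_invX : antidiag_inv 'X = - s1 - s2.
Proof. by rewrite [LHS]/= map_polyX /horner_eval hornerX. Qed.

Lemma antidiagK : cancel antidiag antidiag_inv.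
Proof.
apply: (@mpoly_rmorph_ext _ _ _ (antidiag_inv \o antidiag) idfun) => [a|i].
  by rewrite -[LHS]/(antidiag_inv (antidiag _)) [antidiag _]mmapC antidiag_invC lift_sC.
rewrite -[LHS]/(antidiag_inv (mmap _ _ _)) mmapX mmap1U.
have [->|->] := ord2E i; rewrite [X in antidiag_inv X]/=.
  by rewrite antidiag_invC lift_sX.
rewrite rmorphB rmorphN antidiag_invC antidiag_invX lift_sX.
by rewrite -[RHS]/s2; ring.
Qed.

(** The hypothesis makes l a root of [antidiag b]; the factor theorem is pulled back through
    [antidiag_inv]. *)
Lemma specialize_eq0 l b : specialize l b = 0 ->
  exists q, b = q * (s1 + s2 + l%:~R).
Proof.
rewrite antidiag_specialize => /eqP/factor_theorem[q e].
(* The linear factor X - l becomes -(s_1 + s_2 + l), whence the sign. *)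
exists (- antidiag_inv q); rewrite -[LHS]antidiagK e rmorphM rmorphB.
rewrite antidiag_invX antidiag_invC rmorph_int.
by ring.
Qed.

Lemma specialize_diag l : specialize l (s1 + s2 + l%:~R) = 0.
Proof.
rewrite !rmorphD rmorph_int /= specialize_s1 specialize_s2.
by ring.
Qed.

Lemma LsetE (b : Css) l : Lset b l <-> specialize l b = 0.
Proof.
split; last exact: specialize_eq0.
by move=> [q ->]; rewrite rmorphM /= specialize_diag mulr0.
Qed.

End Substitutions.

Arguments tau {C}.
Arguments lift_s {C}.
Arguments antidiag {C}.
Arguments antidiag_inv {C}.

(* If [b] had no largest [l] in [Lset b], the polynomial [antidiag b] would have
   infinitely many roots. *)
Lemma e_of_ge (C : numFieldType) (b : {mpoly C[2]}) l :
  b != 0 -> Lset b l -> l <= e_of b.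
Proof.
move=> b0 bl; rewrite /e_of; case: asboolP => [e|ne].
  by move: bl; rewrite e.
case: xgetP => [x _ [_ /(_ l bl)] //|nomax]; exfalso.
have up l1 : Lset b l1 -> exists2 l2, Lset b l2 & l1 < l2.
  move=> bl1; apply: contrapT => none; apply: (nomax l1); split=> // l2 bl2.
  by rewrite leNgt; apply/negP => lt12; apply: none; exists l2.
have chain N : exists x s, [/\ size s = N, path >%R x s &
    forall y, y \in x :: s -> Lset b y].
  elim: N => [|N [x [s [ss ps Ls]]]].
    by exists l, [::]; split=> // y; rewrite inE => /eqP ->.
  have [x' Lx' xx'] := up x (Ls _ (mem_head _ _)).
  exists x', (x :: s); split=> /=; [by rewrite ss|by rewrite xx'|].
  by move=> y; rewrite inE => /orP[/eqP ->|/Ls].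
(* With its head, the chain has one element more than the size of [antidiag b], too many for the
   roots of a nonzero polynomial. *)
have [x [s [ss ps Ls]]] := chain (size (antidiag b)).
pose rs : seq {poly C} := [seq y%:~R | y <- x :: s].
(* Characteristic 0 keeps distinct integers distinct. *)
have inj : injective (fun y : int => y%:~R : {poly C}).
  move=> y z; rewrite -!(rmorph_int (@polyC C)) => /polyC_inj/eqP.
  by rewrite eqr_int => /eqP.
have ab0 : antidiag b != 0.
  by apply: contra_neq b0 => e; rewrite -[LHS]antidiagK e raddf0.
have roots : all (root (antidiag b)) rs.
  apply/allP => _ /mapP[y ys ->]; apply/eqP; rewrite -antidiag_specialize.
  exact/LsetE/Ls.
have urs : uniq rs.
  rewrite map_inj_uniq //; apply: (@sorted_uniq _ >%R) => //.
  - by move=> y z t zy /lt_trans; apply.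
  - exact: ltxx.
by have := max_poly_roots ab0 roots urs; rewrite size_map /= ss ltnNge leqnSn.
Qed.

(** * Annihilators *)

Section Annihilators.
Variables (C : numFieldType) (n : nat).
Local Notation Cs := {poly C}.
Local Notation Css := {mpoly C[2]}.
Local Notation s1 := (s1 C).
Local Notation s2 := (s2 C).

Lemma map_to_s (phi : {rmorphism Cs -> Cs}) (f : {mpoly C[n]}) :
  (forall c, phi c%:P = c%:P) -> map_mpoly phi (to_s f) = to_s f.
Proof. exact: (@map_map_mpoly _ _ _ _ (@polyC C) phi (@polyC C)). Qed.

Lemma specialize_to_ss l (f : {mpoly C[n]}) :
  map_mpoly (specialize l) (to_ss f) = to_s f.
Proof.
apply: (@map_map_mpoly _ _ _ _ (@mpolyC 2 C) (specialize l) (@polyC C)).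
exact: specializeC.
Qed.

Lemma tau_to_ss (f : {mpoly C[n]}) : map_mpoly tau (to_ss f) = to_ss f.
Proof.
apply: (@map_map_mpoly _ _ _ _ (@mpolyC 2 C) tau (@mpolyC 2 C)).
exact: tauC.
Qed.

Lemma to_s_neq0 (f : {mpoly C[n]}) : f != 0 -> to_s f != 0.
Proof.
apply: contra_neq => e; apply/mpolyP => m; apply: (@polyC_inj C).
by rewrite -mcoeff_map_mpoly -/(to_s f) e !mcoeff0.
Qed.

Lemma to_ss_neq0 (f : {mpoly C[n]}) : f != 0 -> to_ss f != 0.
Proof.
move=> /to_s_neq0; apply: contra_neq => e.
by rewrite -(specialize_to_ss 0) e raddf0.
Qed.

Variables f g : {mpoly C[n]}.
Hypotheses (f_neq0 : f != 0) (g_neq0 : g != 0).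
Local Notation F := (to_s f).
Local Notation G := (to_s g).
Local Notation FF := (to_ss f).
Local Notation GG := (to_ss g).
(* The annihilator of [g^-l (f/g)^s], for an integer [l] of any sign. *)
Definition ann_z (l : int) : set (Ds C n) :=
  [set P | pow_act F G 'X (- 'X - l%:~R) P 1 = 0].

(** g^-m (f/g)^s is f^s g^(-s-m), and the factor g^-m is invertible. *)
Lemma ann_sE m : ann_s f g m = ann_z m.
Proof.
have gF : G%:F ^+ m != 0 by rewrite expf_neq0 // tofrac_eq0 to_s_neq0.
have dg : dlog F G (G%:F ^+ m)^-1 (- (0 *+ m)) (- (1 *+ m)).
  by apply: dlogV => //; apply/dlogXn/dlog_r/to_s_neq0.
have e P : act_s f g P (1 / G%:F ^+ m) =
    (G%:F ^+ m)^-1 * pow_act F G 'X (- 'X - m%:~R) P 1.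
  rewrite /act_s div1r -[_^-1 in LHS]mulr1 (pow_act_gauge _ _ _ _ dg).
  by rewrite mul0rn oppr0 addr0.
apply/seteqP; split=> P; rewrite /ann_s /ann_z /= e.
  by move/eqP; rewrite mulf_eq0 invr_eq0 (negbTE gF) => /eqP.
by move=> ->; rewrite mulr0.
Qed.

(** There is no C[s]-torsion: q acts by multiplication in a field. *)
Lemma ann_z_sat l P q : q != 0 -> ann_z l (wpoly q%:MP * P) -> ann_z l P.
Proof.
move=> q0; rewrite /ann_z /= pow_actM pow_act_poly => /eqP.
by rewrite mulf_eq0 tofrac_eq0 mpolyC_eq0 (negbTE q0) => /eqP.
Qed.

Lemma specialize_act l T u u' : specializes (specialize l) u u' ->
  specializes (specialize l) (act_ss f g T u)
    (pow_act F G 'X (- 'X - l%:~R) (wmap (specialize l) T) u').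
Proof.
rewrite -specialize_s2 -[X in pow_act _ _ X _](specialize_s1 _ l).
rewrite -!(specialize_to_ss l).
by apply: specializes_pow_act; rewrite specialize_to_ss to_s_neq0.
Qed.

Lemma sat_ann_spec_sub l : sat (ann_spec f g l) `<=` ann_z l.
Proof.
move=> P [q [q0 [T T0 e]]]; apply: (ann_z_sat q0); rewrite -e.
exact: (specializes_eq0 (specialize_act T (specializes1 _ (specialize l))) T0).
Qed.

Variable b : Css.
Hypotheses (b_neq0 : b != 0) (b_BS : BS_ideal f g b).

(** Each [tau] moves the specialization from l to l + 2, so only the values l + 2j with j >= 1 are
    tested against L_b. *)
Lemma specialize_iter_neq0 l N : e_of b - 1 <= l ->
  specialize l (iter N (fun c => tau (b * c)) 1) != 0.
Proof.
elim: N l => [|N IH] l le_l; first by rewrite rmorph1 oner_eq0.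
rewrite iterS specialize_tau comp_poly_eq0 ?size_XsubC //.
(* The first tested value is l + 2, so e_b <= l + 1 is enough. *)
have lt_l : e_of b < l + 2.
  by apply: le_lt_trans (_ : l + 1 < _); rewrite -?lerBlDr ?ltrD2l.
rewrite rmorphM mulf_neq0 ?IH //; last by rewrite (le_trans le_l) ?lerDl.
by apply/eqP => /LsetE/(e_of_ge b_neq0); rewrite leNgt lt_l.
Qed.

Lemma ann_z_sub_sat l : e_of b - 1 <= l -> ann_z l `<=` sat (ann_spec f g l).
Proof.
move=> le_l P P0; have [P1 bP] := b_BS.
have [B [BQ B_neq0]] : exists B : nat -> Css,
    (forall N, exists Q, pow_act FF GG s1 s2 Q 1 =
      ((B N)%:MP)%:F / (FF * GG)%:F ^+ N) /\ forall N, specialize l (B N) != 0.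
  exists (fun N => iter N (fun c => tau (b * c)) 1); split=> N.
    exact: (functional_equation_iter (to_ss_neq0 f_neq0) (to_ss_neq0 g_neq0)
      (tau_to_ss f) (tau_to_ss g) (tauX _ ord0) (tauX _ ord_max) N (esym bP)).
  exact: specialize_iter_neq0.
(* Reading s as s_1 gives a preimage of P in D[s_1, s_2]. *)
have PE : wmap (specialize l) (wmap lift_s P) = P.
  rewrite (@wmap_comp _ _ _ _ lift_s (specialize l) idfun) ?wmap_id // => x.
  exact: specialize_lift_s.
have [N [T [T0 TE]]] := lift_annihilator (specialize_to_ss l f)
  (specialize_to_ss l g) (specialize_s1 C l) (specialize_s2 C l)
  (to_s_neq0 f_neq0) (to_s_neq0 g_neq0) PE BQ P0.
exists (specialize l (B N)); split; first exact: B_neq0.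
by exists T.
Qed.

Lemma ann_z_sat_ann_spec l : e_of b - 1 <= l -> ann_z l = sat (ann_spec f g l).
Proof.
by move=> le_l; apply/seteqP; split;
   [apply: ann_z_sub_sat|apply: sat_ann_spec_sub].
Qed.

End Annihilators.

(** * Comparison of annihilators for different l *)

Section Shift.
Variables (C : numFieldType) (n : nat) (f g : {mpoly C[n]}).
Hypotheses (f_neq0 : f != 0) (g_neq0 : g != 0).
Local Notation F := (to_s f).
Local Notation G := (to_s g).

(** f^s g^(-s-l) is f^c times f^(s-c) g^(-(s-c)-(c+l)), and the latter is the generator for c + l
    with s replaced by s - c. *)
Lemma ann_z_colon (c : nat) l :
  ann_z f g l = colon (wpoly (F ^+ c)) (shift c%:Z (ann_z f g (c%:Z + l))).
Proof.
pose tr z : {rmorphism {poly C} -> {poly C}} := comp_poly ('X + z%:~R).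
have trC z c' : tr z c'%:P = c'%:P by exact: comp_polyC.
have trX z : tr z 'X = 'X + z%:~R by exact: comp_polyX.
have trK z z' : z + z' = 0 -> cancel (tr z') (tr z).
  move=> e; apply: (@poly_rmorph_ext _ _ (tr z \o tr z') idfun) => [a|].
    by rewrite -[LHS]/(tr z (tr z' _)) !trC.
  rewrite -[LHS]/(tr z (tr z' _)) !trX rmorphD trX rmorph_int -addrA -intrD e.
  by rewrite addr0.
have shE (T : Ds C n) :
    wmap (fun p : {poly C} => p \Po ('X - c%:~R)) T = wmap (tr (- c%:Z)) T.
  by rewrite /tr mulrNz.
have trF z (h : {mpoly C[n]}) : map_mpoly (tr z) (to_s h) = to_s h.
  exact: map_to_s (trC z).
(* Here [phi] sends s to s + c and [psi] sends s to s - c. *)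
have key := annihilator_shift 'X (- 'X - l%:~R) c
  (to_s_neq0 f_neq0) (to_s_neq0 g_neq0) (trF c f) (trF c g)
  (trF (- c%:Z) f) (trF (- c%:Z) g) (trK _ _ (addNr c%:Z)).
have trX1 : tr c ('X - c%:R) = 'X by rewrite rmorphB rmorph_nat trX addrK.
have trX2 : tr c (- 'X - l%:~R) = - 'X - (c%:Z + l)%:~R.
  by rewrite rmorphB rmorphN trX rmorph_int intrD !opprD addrA.
apply/seteqP; split=> A.
  move=> /key[T []]; rewrite trX1 trX2 => T0 TA.
  exists T; first exact: T0.
  by apply: etrans (shE T) _; move: TA; exact.
move=> [T T0 TA]; apply/key; exists T.
rewrite trX1 trX2; split; first exact: T0.
apply: etrans (esym (shE T)) _; move: TA; exact.
Qed.

End Shift.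

(** * The generator attaining epsilon, and the two cases *)

Lemma epsilonE (C : numFieldType) (r : nat) (b : 'I_r.+1 -> {mpoly C[2]}) :
  exists i, epsilon b = e_of (b i) - 1.
Proof.
rewrite /epsilon; set m := \big[_/_]_(i < _) _.
suff [i ->] : exists i, m = e_of (b i) by exists i.
rewrite /m; elim/big_ind: _ => [|x y [i ->] [j ->]|i _]; last by exists i.
  by exists ord0.
by rewrite minEle; case: ifP => _; [exists i|exists j].
Qed.

Theorem mainTheorem2 (R : realType) (n : nat) (f g : {mpoly R[i][n]})
    (f_nonconstant : forall c : R[i], f <> c%:MP)
    (g_nonconstant : forall c : R[i], g <> c%:MP)
    (m : nat) (r : nat) (b : 'I_r.+1 -> {mpoly R[i][2]})
    (b_nonzero : forall i, b i != 0)
    (b_generators : generates b (BS_ideal f g)) :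
  let eps := epsilon b in
  let gamma := eps - m%:Z in
  (gamma <= 0 -> ann_s f g m = sat (ann_spec f g m%:Z)) /\
  (0 < gamma ->
     let J := sat (ann_spec f g eps) in
     let fgamma := wpoly (to_s f ^+ `|gamma|%N) in
     (forall (p : nat) (Q : 'I_p -> Ds R[i] n),
        left_ideal_of Q = shift gamma J ->
        ann_s f g m = fst @` syz fgamma Q) /\
     ann_s f g m = colon fgamma (shift gamma J)).
Proof.
move=> eps gamma.
have f0 : f != 0 by apply/eqP; rewrite -(mpolyC0 n); apply: f_nonconstant.
have g0 : g != 0 by apply/eqP; rewrite -(mpolyC0 n); apply: g_nonconstant.
have [i0 epsE] := epsilonE b.
have b_BS : BS_ideal f g (b i0).
  (* Kronecker coefficients exhibit the chosen generator as a member of the ideal. *)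
  rewrite b_generators; exists (fun i => (i == i0)%:R).
  rewrite (bigD1 i0) //= eqxx mul1r big1 ?addr0 // => i /negbTE ->.
  by rewrite mul0r.
have satE l : eps <= l -> ann_z f g l = sat (ann_spec f g l).
  move=> le_l; apply: (ann_z_sat_ann_spec f0 g0 (b_nonzero i0) b_BS).
  by rewrite -epsE.
split=> [|gamma_gt0]; first by rewrite /gamma subr_le0 ann_sE // => /satE.
move=> J fgamma.
have annE : ann_s f g m = colon fgamma (shift gamma J).
  (* As gamma + m = epsilon, the colon formula leads to the annihilator for l = epsilon, where
     [satE] applies. *)
  rewrite ann_sE // (ann_z_colon f0 g0 `|gamma|%N) gtz0_abs //.
  by rewrite subrK satE.
by split=> // p Q QJ; rewrite annE -QJ syz_colon.
Qed.
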